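(* Let $\mathbb{K}$ be a field and let $G=\mathbf{G}_{\underline{\ell}}$ be a multi-path graph of mixed type, with even part $G_e$ and odd part $G_o$. Then \[ \mathbb{K}[G]\cong\mathbb{K}[G_e]\otimes_{\mathbb{K}}\mathbb{K}[G_o]. \] Moreover, for any monomial order $<_e$ on $\mathbb{K}[E(G_e)]$ and any monomial order $<_o$ on $\mathbb{K}[E(G_o)]$, there exists a monomial order $<$ on $\mathbb{K}[E(G)]$ such that \[ \mathbb{K}[E(G)]/\mathrm{in}_<(I_G)\cong\bigl(\mathbb{K}[E(G_e)]/\mathrm{in}_{<_e}(I_{G_e})\bigr)\otimes_{\mathbb{K}}\bigl(\mathbb{K}[E(G_o)]/\mathrm{in}_{<_o}(I_{G_o})\bigr). \]
   Context: For a finite simple graph $G$ with vertex set $V(G)$ and edge set $E(G)$, $\mathbb{K}[V(G)]$ and $\mathbb{K}[E(G)]$ are the polynomial rings with variables the vertices, respectively the edges, of $G$. The toric ideal $I_G$ is the kernel of $\phi:\mathbb{K}[E(G)]\to\mathbb{K}[V(G)]$, $e=\{x,y\}\mapsto xy$, and the edge ring is $\mathbb{K}[G]=\mathrm{im}\,\phi\cong\mathbb{K}[E(G)]/I_G$. For $m\ge2$ and $\underline{\ell}=(\ell_1,\ldots,\ell_m)$ with all $\ell_i\ge1$ and at most one $\ell_i=1$, the multi-path graph $\mathbf{G}_{\underline{\ell}}$ is the simple graph consisting of $m$ paths of lengths (numbers of edges) $\ell_1,\ldots,\ell_m$, all starting at a common vertex $v_1$ and ending at a common vertex $v_2\ne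 v_1$, and pairwise having no common vertices except $v_1,v_2$. It is of mixed type if at least one $\ell_i$ is even and at least one is odd. In this case its even part $G_e$ (resp. odd part $G_o$) is the subgraph formed by the paths of even (resp. odd) length; it may consist of a single path. *)

(* Defs.v *)
From HB Require Import structures.
From mathcomp Require Import all_boot all_order all_algebra.
From mathcomp Require Import finmap.
From mathcomp Require Import monalg.
From mathcomp Require Import boolp.

Set Implicit Arguments.
Unset Strict Implicit.
Unset Printing Implicit Defensive.

Import GRing.Theory.
Local Open Scope ring_scope.
Local Open Scope quotient_scope.

Section TensorModule.
Context {K : comNzRingType} (A B : lmodType K).

Local Notation F := {malg K[(A * B)%type]}.
Local Notation "[ a , b ]" := (<< (a, b) >> : F).

Inductive tensor_rel : F -> Prop :=
| tensor_relDl a a' b : tensor_rel ([a + a', b] - [a, b] - [a', b])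
| tensor_relDr a b b' : tensor_rel ([a, b + b'] - [a, b] - [a, b'])
| tensor_relZl c a b : tensor_rel ([c *: a, b] - c *: [a, b])
| tensor_relZr c a b : tensor_rel ([a, c *: b] - c *: [a, b])
| tensor_rel0 : tensor_rel 0
| tensor_relD x y : tensor_rel x -> tensor_rel y -> tensor_rel (x + y)
| tensor_relZ c x : tensor_rel x -> tensor_rel (c *: x).

Definition tensor_relb : {pred F} := fun x => `[< tensor_rel x >].

Fact tensor_rel_zmod_closed : zmod_closed tensor_relb.
Proof.
split=> [|x y]; first exact/asboolP/tensor_rel0.
move=> /asboolP hx /asboolP hy; apply/asboolP.
by rewrite -scaleN1r; apply/tensor_relD/tensor_relZ.
Qed.

HB.instance Definition _ :=
  GRing.isZmodClosed.Build F tensor_relb tensor_rel_zmod_closed.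

Definition tensor := Quotient.quot tensor_relb.

HB.instance Definition _ := GRing.Zmodule.on tensor.

Definition tensor_proj (x : F) : tensor := \pi x.

Fact tensor_proj_zmod : zmod_morphism tensor_proj.
Proof. exact: pi_is_zmod_morphism. Qed.

HB.instance Definition _ :=
  GRing.isZmodMorphism.Build F tensor tensor_proj tensor_proj_zmod.

Lemma tensor_projP x y :
  (tensor_proj x = tensor_proj y) <-> tensor_rel (x - y).
Proof.
rewrite /tensor_proj; split.
  by move/eqP; rewrite -Quotient.idealrBE => /asboolP.
by move=> h; apply/eqP; rewrite -Quotient.idealrBE; apply/asboolP.
Qed.

Lemma tensor_projK (t : tensor) : tensor_proj (repr t) = t.
Proof. exact: reprK. Qed.

Definition tensor_scale (c : K) (t : tensor) : tensor :=
  tensor_proj (c *: repr t).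

Fact tensor_scale_proj c x : tensor_scale c (tensor_proj x) = tensor_proj (c *: x).
Proof.
apply/tensor_projP; rewrite -scalerBr; apply/tensor_relZ/tensor_projP.
exact: tensor_projK.
Qed.

Fact tensor_scaleA a b v :
  tensor_scale a (tensor_scale b v) = tensor_scale (a * b) v.
Proof. by rewrite -[v]tensor_projK !tensor_scale_proj scalerA. Qed.

Fact tensor_scale1 : left_id 1 tensor_scale.
Proof. by move=> v; rewrite -[v]tensor_projK tensor_scale_proj scale1r. Qed.

Fact tensor_scaleDr : right_distributive tensor_scale +%R.
Proof.
move=> c u v; rewrite -[u]tensor_projK -[v]tensor_projK.
by rewrite -raddfD !tensor_scale_proj scalerDr raddfD.
Qed.

Fact tensor_scaleDl v : {morph tensor_scale^~ v : a b / a + b}.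
Proof.
by move=> a b; rewrite -[v]tensor_projK !tensor_scale_proj scalerDl raddfD.
Qed.

HB.instance Definition _ := GRing.Zmodule_isLmodule.Build K tensor
  tensor_scaleA tensor_scale1 tensor_scaleDr tensor_scaleDl.

Lemma tensor_projZ c x : tensor_proj (c *: x) = c *: tensor_proj x.
Proof. by rewrite -tensor_scale_proj. Qed.

Fact pure_tensor_key : unit. Proof. exact: tt. Qed.
Definition pure_tensor : A -> B -> tensor := locked_with pure_tensor_key
  (fun a b => tensor_proj [a, b]).
Canonical pure_tensor_unlockable := [unlockable fun pure_tensor].

Lemma pure_tensorDl a a' b :
  pure_tensor (a + a') b = pure_tensor a b + pure_tensor a' b.
Proof.
rewrite unlock -raddfD; apply/tensor_projP.
rewrite opprD addrA; exact: tensor_relDl.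
Qed.

Lemma pure_tensorDr a b b' :
  pure_tensor a (b + b') = pure_tensor a b + pure_tensor a b'.
Proof.
rewrite unlock -raddfD; apply/tensor_projP.
rewrite opprD addrA; exact: tensor_relDr.
Qed.

Lemma pure_tensorZl c a b : pure_tensor (c *: a) b = c *: pure_tensor a b.
Proof. rewrite unlock -tensor_projZ; apply/tensor_projP; exact: tensor_relZl. Qed.

Lemma pure_tensorZr c a b : pure_tensor a (c *: b) = c *: pure_tensor a b.
Proof. rewrite unlock -tensor_projZ; apply/tensor_projP; exact: tensor_relZr. Qed.

Lemma tensor_ind (P : tensor -> Prop) :
  P 0 -> (forall x y, P x -> P y -> P (x + y)) ->
  (forall a b, P (pure_tensor a b)) -> forall x, P x.
Proof.
move=> P0 PD Pp x; rewrite -[x]tensor_projK [repr x]monalgE raddf_sum /=.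
apply: (big_ind P) => // -[a b] _.
have -> : << (repr x)@_(a, b) *g (a, b) >> = (repr x)@_(a, b) *: [a, b].
  by apply/malgP=> k; rewrite mcoeffZ !mcoeffU mulr_natr.
rewrite tensor_projZ.
have -> : tensor_proj [a, b] = pure_tensor a b by rewrite unlock.
by rewrite -pure_tensorZl.
Qed.

Definition bilinear_map (V : lmodType K) (f : A -> B -> V) : Prop :=
  (forall a, linear (f a)) /\ (forall b, linear (f^~ b)).

(* Meaningful for bilinear f only. *)
Definition tensor_lift (V : lmodType K) (f : A -> B -> V) (t : tensor) : V :=
  \sum_(p <- msupp (repr t)) (repr t)@_p *: f p.1 p.2.

Section Lift.
Context (V : lmodType K) (f : A -> B -> V).

Let L (x : F) : V := \sum_(p <- msupp x) x@_p *: f p.1 p.2.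

Let LEw (d : {fset A * B}) x : (msupp x `<=` d)%fset ->
  L x = \sum_(p <- d) x@_p *: f p.1 p.2.
Proof.
move=> le; rewrite /L (big_fset_incl _ le) //= => p _ /mcoeff_outdom ->.
by rewrite scale0r.
Qed.

Let LP c x y : L (c *: x + y) = c *: L x + L y.
Proof.
pose d := (msupp (c *: x + y) `|` msupp x `|` msupp y)%fset.
rewrite !(@LEw d) /d.
- rewrite scaler_sumr -big_split /=; apply: eq_bigr => p _.
  by rewrite mcoeffD mcoeffZ scalerDl scalerA.
- exact: fsubsetUr.
- by rewrite fsetUAC fsubsetUr.
- by rewrite -fsetUA fsubsetUl.
Qed.

Let LD x y : L (x + y) = L x + L y.
Proof. by have := LP 1 x y; rewrite !scale1r. Qed.

Let L0 : L 0 = 0.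
Proof. by rewrite /L msupp0 big_seq_fset0. Qed.

Let LZ c x : L (c *: x) = c *: L x.
Proof. by have := LP c x 0; rewrite L0 !addr0. Qed.

Let LB x y : L (x - y) = L x - L y.
Proof. by rewrite LD -[- y]scaleN1r LZ scaleN1r. Qed.

Let LU a b : L [a, b] = f a b.
Proof. by rewrite /L msuppU oner_eq0 big_seq_fset1 mcoeffUU scale1r. Qed.

Hypothesis fbil : bilinear_map f.

Let L_rel x : tensor_rel x -> L x = 0.
Proof.
case: fbil => fr fl; elim=> {x}.
- move=> a a' b; rewrite !LB !LU -{1}[a]scale1r [X in X - _ - _]fl.
  by rewrite scale1r addrAC addrK subrr.
- move=> a b b'; rewrite !LB !LU -{1}[b]scale1r fr.
  by rewrite scale1r addrAC addrK subrr.
- move=> c a b; rewrite LB LZ !LU -[_ *: a]addr0 [X in X - _]fl.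
  have -> : f 0 b = 0.
    by have := fl b (-1) 0 0; rewrite scaleN1r oppr0 addr0 scaleN1r addNr.
  by rewrite addr0 subrr.
- move=> c a b; rewrite LB LZ !LU -[_ *: b]addr0 fr.
  have -> : f a 0 = 0.
    by have := fr a (-1) 0 0; rewrite scaleN1r oppr0 addr0 scaleN1r addNr.
  by rewrite addr0 subrr.
- exact: L0.
- by move=> x y _ hx _ hy; rewrite LD hx hy addr0.
- by move=> c x _ hx; rewrite LZ hx scaler0.
Qed.

Let lift_proj x : tensor_lift f (tensor_proj x) = L x.
Proof.
apply/eqP; rewrite -subr_eq0 -[tensor_lift _ _]/(L _) -LB; apply/eqP.
by apply: L_rel; apply/tensor_projP; rewrite tensor_projK.
Qed.

Lemma tensor_lift_linear : linear (tensor_lift f).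
Proof.
move=> c x y; rewrite -[x]tensor_projK -[y]tensor_projK.
by rewrite -tensor_projZ -raddfD !lift_proj LP.
Qed.

Lemma tensor_lift_pure a b : tensor_lift f (pure_tensor a b) = f a b.
Proof. by rewrite unlock lift_proj LU. Qed.

End Lift.
End TensorModule.

Notation "A ⊗ B" := (tensor A B) (at level 40, left associativity) : type_scope.

Lemma tensor_linear_ext (K : comNzRingType) (A B V : lmodType K)
    (f g : A ⊗ B -> V) :
  linear f -> linear g ->
  (forall a b, f (pure_tensor a b) = g (pure_tensor a b)) -> f =1 g.
Proof.
move=> fl gl fg.
have f0 : f 0 = 0.
  by have := fl (-1) 0 0; rewrite scaleN1r oppr0 addr0 scaleN1r addNr.
have g0 : g 0 = 0.
  by have := gl (-1) 0 0; rewrite scaleN1r oppr0 addr0 scaleN1r addNr.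
apply: tensor_ind => [|x y hx hy|//]; first by rewrite f0 g0.
by rewrite -[x]scale1r fl gl hx hy.
Qed.

Fact linear_combination (K : comNzRingType) (U V : lmodType K) (c : K)
    (f g : U -> V) :
  linear f -> linear g -> linear (fun x => c *: f x + g x).
Proof.
move=> fl gl d x y; rewrite fl gl !scalerDr !scalerA mulrC.
by rewrite addrACA.
Qed.

Section TensorAlgebra.
Context {K : comNzRingType} (A B : comAlgType K).
Local Notation T := (tensor A B).

(* (a ⊗ b) (a' ⊗ b') = a a' ⊗ b b', extended bilinearly. *)
Definition tensor_mulp (a : A) (b : B) : T -> T :=
  tensor_lift (fun a' b' => pure_tensor (a * a') (b * b')).

Fact tensor_mul_key : unit. Proof. exact: tt. Qed.
Definition tensor_mul : T -> T -> T := locked_with tensor_mul_key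
  (fun x y => tensor_lift (fun a b => tensor_mulp a b y) x).
Canonical tensor_mul_unlockable := [unlockable fun tensor_mul].

Definition tensor_one : T := pure_tensor 1 1.

Fact tensor_mulp_bil (a : A) (b : B) :
  bilinear_map (fun a' b' => pure_tensor (a * a') (b * b') : T).
Proof.
split=> [a' c x y|b' c x y].
  by rewrite mulrDr -scalerAr pure_tensorDr pure_tensorZr.
by rewrite mulrDr -scalerAr pure_tensorDl pure_tensorZl.
Qed.

Fact tensor_mulpE a b a' b' :
  tensor_mulp a b (pure_tensor a' b') = pure_tensor (a * a') (b * b').
Proof. exact: tensor_lift_pure (tensor_mulp_bil a b) a' b'. Qed.

Fact tensor_mulp_linear a b : linear (tensor_mulp a b).
Proof. exact: tensor_lift_linear (tensor_mulp_bil a b). Qed.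

Fact tensor_mulr_bil (y : T) : bilinear_map (fun a b => tensor_mulp a b y).
Proof.
split=> [a c b b'|b c a a'] /=.
  apply: (tensor_linear_ext (f := tensor_mulp a (c *: b + b'))
    (g := fun y => c *: tensor_mulp a b y + tensor_mulp a b' y)) => {y}.
  - exact: tensor_mulp_linear.
  - apply: linear_combination; exact: tensor_mulp_linear.
  - move=> a1 b1; rewrite !tensor_mulpE (mulrDl (c *: b)) -(scalerAl c b b1).
    by rewrite pure_tensorDr pure_tensorZr.
apply: (tensor_linear_ext (f := tensor_mulp (c *: a + a') b)
  (g := fun y => c *: tensor_mulp a b y + tensor_mulp a' b y)) => {y}.
- exact: tensor_mulp_linear.
- apply: linear_combination; exact: tensor_mulp_linear.
- move=> a1 b1; rewrite !tensor_mulpE (mulrDl (c *: a)) -(scalerAl c a a1).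
  by rewrite pure_tensorDl pure_tensorZl.
Qed.

Fact tensor_mul_linearl y : linear (tensor_mul^~ y).
Proof.
by move=> c u v; rewrite unlock (tensor_lift_linear (tensor_mulr_bil y)).
Qed.

Fact tensor_mul_purel a b y : tensor_mul (pure_tensor a b) y = tensor_mulp a b y.
Proof. by rewrite unlock (tensor_lift_pure (tensor_mulr_bil y)). Qed.

Fact tensor_mul_pure a b a' b' :
  tensor_mul (pure_tensor a b) (pure_tensor a' b') =
  pure_tensor (a * a') (b * b').
Proof. by rewrite tensor_mul_purel tensor_mulpE. Qed.

Fact tensor_mul_linearr x : linear (tensor_mul x).
Proof.
move=> c y z; apply: (tensor_linear_ext (f := tensor_mul^~ (c *: y + z))
  (g := fun x => c *: tensor_mul x y + tensor_mul x z)) => {x}.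
- exact: tensor_mul_linearl.
- apply: linear_combination; exact: tensor_mul_linearl.
- by move=> a b; rewrite !tensor_mul_purel tensor_mulp_linear.
Qed.

Let mulDl : left_distributive tensor_mul +%R.
Proof.
by move=> x y z; rewrite -[x]scale1r [LHS]tensor_mul_linearl !scale1r.
Qed.

Let mulDr : right_distributive tensor_mul +%R.
Proof.
by move=> x y z; rewrite -[y]scale1r tensor_mul_linearr !scale1r.
Qed.

Let mul0 x : tensor_mul x 0 = 0.
Proof. by have := mulDr x 0 0; rewrite addr0 -{1}[tensor_mul x 0]addr0 => /addrI<-. Qed.

Let mul0l x : tensor_mul 0 x = 0.
Proof. by have := mulDl 0 0 x; rewrite addr0 -{1}[tensor_mul 0 x]addr0 => /addrI<-. Qed.

Fact tensor_mulC : commutative tensor_mul.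
Proof.
move=> x y; elim/(@tensor_ind K A B): x => [|x x' hx hx'|a b].
- by rewrite mul0 mul0l.
- by rewrite mulDl mulDr hx hx'.
elim/(@tensor_ind K A B): y => [|y y' hy hy'|a' b'].
- by rewrite mul0 mul0l.
- by rewrite mulDl mulDr hy hy'.
- by rewrite !tensor_mul_pure mulrC [b * _]mulrC.
Qed.

Fact tensor_mulA : associative tensor_mul.
Proof.
move=> x y z; elim/(@tensor_ind K A B): x => [|x x' hx hx'|a b].
- by rewrite !mul0l.
- by rewrite !mulDl hx hx'.
elim/(@tensor_ind K A B): y => [|y y' hy hy'|a' b'].
- by rewrite mul0l mul0 mul0l.
- by rewrite mulDl !mulDr mulDl hy hy'.
elim/(@tensor_ind K A B): z => [|z z' hz hz'|a'' b''].
- by rewrite !mul0.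
- by rewrite !mulDr hz hz'.
- by rewrite !tensor_mul_pure !mulrA.
Qed.

Fact tensor_mul1 : left_id tensor_one tensor_mul.
Proof.
elim/(@tensor_ind K A B)=> [|x y hx hy|a b]; first exact: mul0.
- by rewrite mulDr hx hy.
- by rewrite tensor_mul_pure !mul1r.
Qed.

HB.instance Definition _ := GRing.Zmodule_isComPzRing.Build (tensor A B)
  tensor_mulA tensor_mulC tensor_mul1 mulDl.

Lemma pure_tensor1 : pure_tensor 1 1 = 1 :> A ⊗ B.
Proof. by []. Qed.

Lemma pure_tensorM a b a' b' :
  pure_tensor a b * pure_tensor a' b' = pure_tensor (a * a') (b * b') :> A ⊗ B.
Proof. exact: tensor_mul_pure. Qed.

Lemma tensor_scalerAl (c : K) (x y : A ⊗ B) : c *: (x * y) = (c *: x) * y.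
Proof.
by have := tensor_mul_linearl y c x 0; rewrite mul0l !addr0 => /esym.
Qed.

End TensorAlgebra.

(* Isomorphism of K-algebras.  It is not stated with {lrmorphism _ -> _}
   because the library's algebras are nontrivial by definition, whereas
   1 != 0 is not part of the construction of B ⊗ C. *)
Definition iso_tensor (K : comNzRingType) (A B C : comAlgType K) : Prop :=
  exists f : A -> B ⊗ C, [/\ linear f, monoid_morphism f & bijective f].

Section QuotientAlgebra.
Context {K : comNzRingType} {R : comAlgType K} (I : idealr R).

Definition quot_alg := {ideal_quot I}.

HB.instance Definition _ := GRing.ComNzRing.on quot_alg.

Definition quot_proj (x : R) : quot_alg := \pi_(quot_alg) x.

Lemma quot_projK (t : quot_alg) : quot_proj (repr t) = t.
Proof. exact: reprK. Qed.

Lemma quot_projP x y : (quot_proj x == quot_proj y) = (x - y \in I).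
Proof. by rewrite [RHS]Quotient.idealrBE. Qed.

Fact quot_proj_zmod : zmod_morphism quot_proj.
Proof. exact: pi_is_zmod_morphism. Qed.

Fact quot_proj_monoid : monoid_morphism quot_proj.
Proof. exact: pi_is_monoid_morphism. Qed.

HB.instance Definition _ :=
  GRing.isZmodMorphism.Build R quot_alg quot_proj quot_proj_zmod.
HB.instance Definition _ :=
  GRing.isMonoidMorphism.Build R quot_alg quot_proj quot_proj_monoid.

Definition quot_scale (c : K) (t : quot_alg) : quot_alg :=
  quot_proj (c *: repr t).

Fact quot_scale_proj c x : quot_scale c (quot_proj x) = quot_proj (c *: x).
Proof.
apply/eqP; rewrite quot_projP -scalerBr -mulr_algl; apply: idealMr.
by rewrite -quot_projP quot_projK.
Qed.

Fact quot_scaleA a b v : quot_scale a (quot_scale b v) = quot_scale (a * b) v.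
Proof. by rewrite -[v]quot_projK !quot_scale_proj scalerA. Qed.

Fact quot_scale1 : left_id 1 quot_scale.
Proof. by move=> v; rewrite -[v]quot_projK quot_scale_proj scale1r. Qed.

Fact quot_scaleDr : right_distributive quot_scale +%R.
Proof.
move=> c u v; rewrite -[u]quot_projK -[v]quot_projK.
by rewrite -raddfD !quot_scale_proj scalerDr raddfD.
Qed.

Fact quot_scaleDl v : {morph quot_scale^~ v : a b / a + b}.
Proof.
by move=> a b; rewrite -[v]quot_projK !quot_scale_proj scalerDl raddfD.
Qed.

HB.instance Definition _ := GRing.Zmodule_isLmodule.Build K quot_alg
  quot_scaleA quot_scale1 quot_scaleDr quot_scaleDl.

Lemma quot_projZ c x : quot_proj (c *: x) = c *: quot_proj x.
Proof. by rewrite -quot_scale_proj. Qed.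

Fact quot_scaleAl (c : K) (u v : quot_alg) : c *: (u * v) = (c *: u) * v.
Proof.
rewrite -[u]quot_projK -[v]quot_projK -rmorphM -!quot_projZ -rmorphM.
by rewrite scalerAl.
Qed.

HB.instance Definition _ :=
  GRing.Lmodule_isLalgebra.Build K quot_alg quot_scaleAl.
HB.instance Definition _ := GRing.Lalgebra_isComAlgebra.Build K quot_alg.

End QuotientAlgebra.

Arguments quot_alg {K} R I.

(* Vertices live in an ambient finite type, so that a subgraph is again a
   graph over the same type, with its own vertex and edge sets. *)
Record sgraph (T : finType) := SGraph {
  verts : {set T};
  edges : {set {set T}};
  edgesP : forall e, e \in edges -> (e \subset verts) && (#|e| == 2%N) }.

Definition vertex (T : finType) (G : sgraph T) : finType :=
  {x : T | x \in verts G}.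
Definition edge (T : finType) (G : sgraph T) : finType :=
  {e : {set T} | e \in edges G}.

(* The polynomial ring as the monoid algebra of the free commutative monoid
   {cmonom X} on the variables X. *)
Notation polyring K X := {malg K[{cmonom X}]}.

Section ToricIdeal.
Context (K : fieldType) (T : finType) (G : sgraph T).

Definition edge_image (e : edge G) : polyring K (vertex G) :=
  \prod_(x : vertex G | val x \in val e) << ucm x >>.

Definition toric_mon (u : {cmonom (edge G)}) : polyring K (vertex G) :=
  \prod_(e : edge G) edge_image e ^+ u e.

Fact toric_mon_mmorphism : mmorphism toric_mon.
Proof.
split=> [u v|]; rewrite /toric_mon.
  by rewrite -big_split /=; apply: eq_bigr => e _; rewrite cmM exprD.
by rewrite big1 // => e _; rewrite cm1 expr0.
Qed.

HB.instance Definition _ := isMultiplicative.Build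
  {cmonom (edge G)} (polyring K (vertex G)) toric_mon toric_mon_mmorphism.

Definition toric_map (f : polyring K (edge G)) : polyring K (vertex G) :=
  mmap (@mkmalgU {cmonom (vertex G)} K mone) toric_mon f.

Fact toric_map_zmod : zmod_morphism toric_map.
Proof. exact: raddfB. Qed.

Fact toric_map_monoid : monoid_morphism toric_map.
Proof. by split; [exact: rmorph1|exact: rmorphM]. Qed.

Fact toric_map_scalable : scalable toric_map.
Proof. by move=> c f; rewrite /toric_map mmapZ mul_malgC. Qed.

HB.instance Definition _ :=
  GRing.isZmodMorphism.Build _ _ toric_map toric_map_zmod.
HB.instance Definition _ :=
  GRing.isMonoidMorphism.Build _ _ toric_map toric_map_monoid.
HB.instance Definition _ :=
  GRing.isScalable.Build K _ _ *:%R toric_map toric_map_scalable.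

Lemma toric_mapX (e : edge G) : toric_map << ucm e >> = edge_image e.
Proof.
rewrite /toric_map mmapU mul1r /toric_mon (bigD1 e) //= cmUU expr1.
by rewrite big1 ?mulr1 // => e' ne; rewrite cmU eq_sym (negbTE ne) expr0.
Qed.

Definition toric_ideal : {pred polyring K (edge G)} :=
  fun f => toric_map f == 0.

Fact toric_ideal_closed : idealr_closed toric_ideal.
Proof.
have E f : (f \in toric_ideal) = (toric_map f == 0) by [].
split=> [||f g h]; rewrite !E.
- by rewrite raddf0.
- by rewrite rmorph1 oner_eq0.
- by move=> /eqP g0 /eqP h0; rewrite rmorphD rmorphM /= g0 h0 mulr0 addr0.
Qed.

HB.instance Definition _ := isIdealr.Build _ toric_ideal toric_ideal_closed.

Definition toric_image : {pred polyring K (vertex G)} :=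
  fun g => `[< exists f, toric_map f = g >].

Fact toric_imageP g : reflect (exists f, toric_map f = g) (g \in toric_image).
Proof. exact: asboolP. Qed.

Fact toric_image_closed : GRing.subsemialg_closed toric_image.
Proof.
split; [|split|..].
- by apply/toric_imageP; exists 1; rewrite rmorph1.
- by apply/toric_imageP; exists 0; rewrite rmorph0.
- move=> _ _ /toric_imageP[f <-] /toric_imageP[g <-]; apply/toric_imageP.
  by exists (f + g); rewrite rmorphD.
- move=> c _ /toric_imageP[f <-]; apply/toric_imageP.
  by exists (c *: f); rewrite linearZ.
- move=> _ _ /toric_imageP[f <-] /toric_imageP[g <-]; apply/toric_imageP.
  by exists (f * g); rewrite rmorphM.
Qed.

Record edge_ring := EdgeRing {
  edge_ring_val : polyring K (vertex G);
  edge_ringP : edge_ring_val \in toric_image }.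

HB.instance Definition _ := [isSub for edge_ring_val].
HB.instance Definition _ := [Choice of edge_ring by <:].
HB.instance Definition _ := GRing.SubChoice_isSubAlgebra.Build K
  (polyring K (vertex G)) toric_image edge_ring toric_image_closed.
HB.instance Definition _ := GRing.SubNzRing_isSubComNzRing.Build
  (polyring K (vertex G)) toric_image edge_ring.
HB.instance Definition _ := GRing.Lalgebra_isComAlgebra.Build K edge_ring.

End ToricIdeal.

Arguments toric_ideal K {T} G.
Arguments edge_ring K {T} G.

(* For finite X, being a well-order follows from these axioms. *)
Record monomial_order (X : choiceType) := MonomialOrder {
  mle :> rel {cmonom X};
  mle_anti : antisymmetric mle;
  mle_trans : transitive mle;
  mle_total : total mle;
  mle1 : forall u, mle mone u;
  mleM : forall u v w, mle u v -> mle (mmul u w) (mmul v w) }.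

Definition ideal_generated (R : comNzRingType) (S : R -> Prop) : {pred R} :=
  fun x => `[< exists s : seq (R * R),
    (forall p, p \in s -> S p.2) /\ x = \sum_(p <- s) p.1 * p.2 >].

Fact ideal_generated_lin (R : comNzRingType) (S : R -> Prop) a :
  {in ideal_generated S &, forall x y, a * x + y \in ideal_generated S}.
Proof.
move=> x y /asboolP[s [sI ->]] /asboolP[t [tI ->]]; apply/asboolP.
exists ([seq (a * p.1, p.2) | p <- s] ++ t); split=> [p|].
  by rewrite mem_cat => /orP[/mapP[q /sI qI ->]|/tI].
rewrite big_cat big_map mulr_sumr; congr (_ + _).
by apply: eq_bigr => p _; rewrite mulrA.
Qed.

Section InitialIdeal.
Context (K : fieldType) (X : choiceType) (le : monomial_order X).
Local Notation R := (polyring K X).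

(* There is such a u iff f != 0. *)
Definition is_initial (f : R) (u : {cmonom X}) : Prop :=
  u \in msupp f /\ forall v, v \in msupp f -> le v u.

Definition initial_ideal (I : {pred R}) : {pred R} :=
  ideal_generated
    (fun g : R => exists f u, [/\ f \in I, is_initial f u & g = << u >>]).

Fact initial_ideal_closed (I : idealr R) : idealr_closed (initial_ideal I).
Proof.
split.
- by apply/asboolP; exists [::]; rewrite big_nil.
- apply/negP => /asboolP[s [sI]] /(congr1 (mcoeff mone)).
  rewrite mcoeff1 eqxx raddf_sum /= big1_seq => [/eqP|p /= /sI].
    by rewrite oner_eq0.
  case=> f [u [fI [uf leu] ->]]; rewrite rmorphM /= mcoeffU1.
  case: eqVneq => [u1|_]; last by rewrite mulr0.
  have fE : f = (f@_mone)%:MP.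
    apply/malgP=> v; rewrite mcoeffC; case: eqVneq => [->//|v1].
    apply: mcoeff_outdom; apply: contra v1 => /leu; rewrite u1 => le1.
    by rewrite (@mle_anti _ le v mone) // le1 mle1.
  suff: (1 : R) \in I by rewrite idealr1.
  have c0 : f@_mone != 0 by rewrite mcoeff_neq0 -u1.
  have -> : (1 : R) = ((f@_mone)^-1)%:MP * f.
    rewrite mul_malgC; apply/malgP => v; rewrite mcoeffZ mcoeff1 {2}fE mcoeffC.
    by rewrite eq_sym; case: eqVneq => _ /=; rewrite ?mulr1n ?mulr0n ?mulVf ?mulr0.
  exact: idealMr.
- exact: ideal_generated_lin.
Qed.

HB.instance Definition _ (I : idealr R) :=
  isIdealr.Build R (initial_ideal I) (initial_ideal_closed I).

End InitialIdeal.

Section MultiPath.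
Context (m : nat) (l : 'I_m -> nat).

Definition multipath_lengths : Prop :=
  [/\ (2 <= m)%N, forall i, (1 <= l i)%N
    & forall i j, l i = 1%N -> l j = 1%N -> i = j].

Definition mixed_type : Prop :=
  (exists i, ~~ odd (l i)) /\ (exists i, odd (l i)).

(* The two end vertices, and l i - 1 inner vertices for each path i. *)
Definition mp_vertex : finType := (bool + {i : 'I_m & 'I_(l i).-1})%type.

Definition mp_v1 : mp_vertex := inl false.
Definition mp_v2 : mp_vertex := inl true.

(* Intended for 0 <= k <= l i: v_1 for k = 0 and v_2 for k = l i. *)
Definition path_vertex (i : 'I_m) (k : nat) : mp_vertex :=
  if k == 0%N then mp_v1
  else if (insub k.-1 : option 'I_(l i).-1) is Some j
  then inr (existT (fun i => 'I_(l i).-1) i j)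
  else mp_v2.

Definition paths_verts (S : {set 'I_m}) : {set mp_vertex} :=
  [set x | [exists i in S, exists k : 'I_(l i).+1, x == path_vertex i k]].

Definition paths_edges (S : {set 'I_m}) : {set {set mp_vertex}} :=
  [set e | [exists i in S, exists k : 'I_(l i),
              e == [set path_vertex i k; path_vertex i k.+1]]].

Fact path_vertex_neq (i : 'I_m) (k : 'I_(l i)) :
  path_vertex i k != path_vertex i k.+1.
Proof.
rewrite /path_vertex /=; case: k => -[|k] /= kl.
  by case: (insub _).
have kl' : (k < (l i).-1)%N by case: (l i) kl.
rewrite (insubT (fun j => (j < (l i).-1)%N) kl') /=.
case: insubP => [j _ /= jk|//]; apply/eqP=> -[] /eqP.
by rewrite eq_Tagged /= => /eqP/(congr1 val)/=; rewrite jk; apply/n_Sn.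
Qed.

Fact paths_edgesP (S : {set 'I_m}) e : e \in paths_edges S ->
  (e \subset paths_verts S) && (#|e| == 2%N).
Proof.
rewrite inE => /exists_inP[i iS] /existsP[k /eqP->].
rewrite cards2 path_vertex_neq andbT; apply/subsetP => x.
rewrite !inE => /orP[] /eqP->; apply/exists_inP; exists i => //; apply/existsP.
  by exists (widen_ord (leqnSn _) k).
by exists (lift ord0 k).
Qed.

(* The union of the paths in S, which need not be an induced subgraph: the
   edge {v_1, v_2} of a path of length 1 outside S is left out. *)
Definition paths_graph (S : {set 'I_m}) : sgraph mp_vertex :=
  SGraph (@paths_edgesP S).

Definition multipath : sgraph mp_vertex := paths_graph setT.
Definition even_part : sgraph mp_vertex := paths_graph [set i | ~~ odd (l i)].
Definition odd_part : sgraph mp_vertex := paths_graph [set i | odd (l i)].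

End MultiPath.

(* Main.v *)
(* Let w be an integral weighting of E(G) whose sum over the edges at each vertex
   vanishes. At an inner vertex only edges of one parity meet, so the vertex sums
   of w restricted to G_e are supported on {v1, v2}. Alternating signs along the
   paths put v1 and v2 in the same class of the bipartite graph G_e and in opposite
   classes of G_o; hence these sums p, q satisfy p + q = 0 and p - q = 0, and
   vanish. So two monomials with the same image under phi already have the same
   image on their even and on their odd parts, which gives the first isomorphism.

   For the second, compare even parts first and then odd parts. If u is the
   initial monomial of f in I_G, then f contains a smaller monomial v with the same
   image as u, since the coefficients over that image add up to 0. By the above,
   either the even parts of u and v differ and their difference is a binomial of
   I_{G_e}, or they agree and the odd parts give a binomial of I_{G_o}. *)

Require Import Defs.
From HB Require Import structures.
From mathcomp Require Import all_boot all_order all_algebra.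
From mathcomp Require Import finmap monalg boolp zify.

Set Implicit Arguments.
Unset Strict Implicit.
Unset Printing Implicit Defensive.

Import GRing.Theory.
Local Open Scope ring_scope.

(** * Linear maps out of a monoid algebra *)

Section MalgLift.
Context (K : comNzRingType) (M : choiceType) (V : lmodType K).

Lemma malg_linear_ind (P : {malg K[M]} -> Prop) :
  P 0 -> (forall c u g, P g -> P (c *: << u >> + g)) -> forall f, P f.
Proof.
move=> P0 PD f; rewrite [f]monalgE; elim: (enum_fset (msupp f)) => [|u s IH].
  by rewrite big_nil.
rewrite big_cons; suff -> : << f@_u *g u >> = f@_u *: << u >> by exact: PD.
by apply/malgP=> v; rewrite mcoeffZ !mcoeffU mulr_natr.
Qed.

Lemma malg_linear_ext (f g : {malg K[M]} -> V) :
  linear f -> linear g -> (forall u, f << u >> = g << u >>) -> f =1 g.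
Proof.
move=> fl gl fg; elim/malg_linear_ind => [|c u h IH]; last by rewrite fl gl fg IH.
by rewrite -[0](addNr 0) -scaleN1r fl gl !scaleN1r !addNr.
Qed.

Definition malg_lift (h : M -> V) (f : {malg K[M]}) : V :=
  \sum_(u <- msupp f) f@_u *: h u.

Context (h : M -> V).

Fact malg_lift_sumw (d : {fset M}) f : (msupp f `<=` d)%fset ->
  malg_lift h f = \sum_(u <- d) f@_u *: h u.
Proof.
move=> le; rewrite /malg_lift (big_fset_incl _ le) //= => u _ /mcoeff_outdom ->.
by rewrite scale0r.
Qed.

Fact malg_lift_linear : linear (malg_lift h).
Proof.
move=> c f g; pose d := (msupp (c *: f + g) `|` msupp f `|` msupp g)%fset.
rewrite !(@malg_lift_sumw d) /d.
- rewrite scaler_sumr -big_split /=; apply: eq_bigr => p _.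
  by rewrite mcoeffD mcoeffZ scalerDl scalerA.
- exact: fsubsetUr.
- by rewrite fsetUAC fsubsetUr.
- by rewrite -fsetUA fsubsetUl.
Qed.

HB.instance Definition _ :=
  GRing.isLinear.Build K {malg K[M]} V *:%R (malg_lift h) malg_lift_linear.

Lemma malg_liftU u : malg_lift h << u >> = h u.
Proof. by rewrite /malg_lift msuppU oner_eq0 big_seq_fset1 mcoeffUU scale1r. Qed.

End MalgLift.

Lemma malgUM (K : comNzRingType) (M : conomType) (u v : M) :
  << u >> * << v >> = << mmul u v >> :> {malg K[M]}.
Proof. by rewrite malgM_def fgmulUU mulr1. Qed.

(** By bilinearity it suffices to compare both sides on monomials. The product [mulV] is left
    arbitrary to cover both [tensor_mul] and the product of a monoid algebra. *)
Lemma malg_lift_mul (K : comNzRingType) (M : conomType) (V : lmodType K)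
    (mulV : V -> V -> V) (h : M -> V) :
  bilinear_map mulV -> (forall u v, h (mmul u v) = mulV (h u) (h v)) ->
  forall f g, malg_lift h (f * g) = mulV (malg_lift h f) (malg_lift h g).
Proof.
move=> [mulVr mulVl] hM.
suff S u g : malg_lift h (<< u >> * g) = mulV (h u) (malg_lift h g).
  move=> f g; move: f; apply: malg_linear_ext => [c x y|c x y|u].
  - by rewrite mulrDl -scalerAl linearP.
  - by rewrite linearP mulVl.
  - by rewrite S malg_liftU.
move: g; apply: malg_linear_ext => [c x y|c x y|v].
- by rewrite mulrDr -scalerAr linearP.
- by rewrite linearP mulVr.
- by rewrite malgUM !malg_liftU.
Qed.

Lemma tensor_mul_bil (K : comNzRingType) (A B : comAlgType K) :
  bilinear_map (@tensor_mul K A B).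
Proof. by split; [exact: tensor_mul_linearr|exact: tensor_mul_linearl]. Qed.

Lemma malg_mul_bil (K : comNzRingType) (M : conomType) :
  bilinear_map (fun f g : {malg K[M]} => f * g).
Proof.
split=> [f c x y|f c x y]; first by rewrite mulrDr -scalerAr.
by rewrite mulrDl -scalerAl.
Qed.

Lemma pure_tensor0l (K : comNzRingType) (A B : lmodType K) (b : B) :
  pure_tensor (0 : A) b = 0.
Proof. by rewrite -[0 in LHS](scale0r (0 : A)) pure_tensorZl scale0r. Qed.

Lemma pure_tensor0r (K : comNzRingType) (A B : lmodType K) (a : A) :
  pure_tensor a (0 : B) = 0.
Proof. by rewrite -[0 in LHS](scale0r (0 : B)) pure_tensorZr scale0r. Qed.

(** * A criterion for a quotient of a monoid algebra to be a tensor product *)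

Section TensorIso.
Context (K : comNzRingType) (M M1 M2 : conomType) (A A1 A2 : comAlgType K).
Context (P : {lrmorphism {malg K[M]} -> A}).
Context (P1 : {lrmorphism {malg K[M1]} -> A1}).
Context (P2 : {lrmorphism {malg K[M2]} -> A2}).
Hypothesis P_surj : forall a, exists f, P f = a.
Hypothesis P1_surj : forall a, exists f, P1 f = a.
Hypothesis P2_surj : forall a, exists f, P2 f = a.
(* These maps identify M with M1 x M2. *)
Context (r1 : M -> M1) (r2 : M -> M2) (i1 : M1 -> M) (i2 : M2 -> M).
Hypothesis r1_1 : r1 mone = mone.
Hypothesis r2_1 : r2 mone = mone.
Hypothesis r1M : {morph r1 : u v / mmul u v}.
Hypothesis r2M : {morph r2 : u v / mmul u v}.
Hypothesis r1K : forall a b, r1 (mmul (i1 a) (i2 b)) = a.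
Hypothesis r2K : forall a b, r2 (mmul (i1 a) (i2 b)) = b.
Hypothesis iK : forall u, mmul (i1 (r1 u)) (i2 (r2 u)) = u.

(** The isomorphism before passing to quotients: [P_ker] lets it descend to [A], while [P1_ker] and
    [P2_ker] let the inclusions of [M1] and [M2] descend to [A1] and [A2], which yields the
    inverse. *)
Definition split_tensor : {malg K[M]} -> A1 ⊗ A2 :=
  malg_lift (fun u => pure_tensor (P1 << r1 u >>) (P2 << r2 u >>)).

Hypothesis P_ker : forall f, P f = 0 -> split_tensor f = 0.
Hypothesis P1_ker : forall f, P1 f = 0 -> P (malg_lift (fun a => << i1 a >>) f) = 0.
Hypothesis P2_ker : forall f, P2 f = 0 -> P (malg_lift (fun a => << i2 a >>) f) = 0.

HB.instance Definition _ := GRing.Linear.on split_tensor.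
Local Notation F := split_tensor.
Local Notation I1 := (malg_lift (fun a => << i1 a >> : {malg K[M]})).
Local Notation I2 := (malg_lift (fun a => << i2 a >> : {malg K[M]})).

Lemma split_tensorM f g : split_tensor (f * g) = split_tensor f * split_tensor g.
Proof.
apply: malg_lift_mul; first exact: tensor_mul_bil.
by move=> u v; rewrite r1M r2M pure_tensorM -!rmorphM !malgUM.
Qed.

Let F1 : F 1 = 1.
Proof.
by rewrite -[1 in LHS]/(<< mone >>) /split_tensor malg_liftU r1_1 r2_1 !rmorph1.
Qed.

Let FI f g : F (I1 f * I2 g) = pure_tensor (P1 f) (P2 g).
Proof.
move: f; apply: malg_linear_ext => [c x y|c x y|a].
- by rewrite linearP mulrDl -scalerAl linearP.
- by rewrite linearP /= pure_tensorDl pure_tensorZl.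
move: g; apply: malg_linear_ext => [c x y|c x y|b].
- by rewrite linearP mulrDr -scalerAr linearP.
- by rewrite linearP /= pure_tensorDr pure_tensorZr.
by rewrite /split_tensor !malg_liftU malgUM malg_liftU r1K r2K.
Qed.

Let s a := sval (cid (P_surj a)).
Let s1 a := sval (cid (P1_surj a)).
Let s2 a := sval (cid (P2_surj a)).
Let sP a : P (s a) = a. Proof. exact: svalP (cid (P_surj a)). Qed.
Let s1P a : P1 (s1 a) = a. Proof. exact: svalP (cid (P1_surj a)). Qed.
Let s2P a : P2 (s2 a) = a. Proof. exact: svalP (cid (P2_surj a)). Qed.

Let FP f g : P f = P g -> F f = F g.
Proof.
move=> fg; apply/eqP; rewrite -subr_eq0 -linearB; apply/eqP/P_ker.
by rewrite raddfB /= fg subrr.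
Qed.
Let I1P f g : P1 f = P1 g -> P (I1 f) = P (I1 g).
Proof.
move=> fg; apply/eqP; rewrite -subr_eq0 -!linearB; apply/eqP/P1_ker.
by rewrite raddfB /= fg subrr.
Qed.
Let I2P f g : P2 f = P2 g -> P (I2 f) = P (I2 g).
Proof.
move=> fg; apply/eqP; rewrite -subr_eq0 -!linearB; apply/eqP/P2_ker.
by rewrite raddfB /= fg subrr.
Qed.

Lemma tensor_iso : iso_tensor A A1 A2.
Proof.
(* The lift of [g] is the inverse. The sections [s1] and [s2] are mere choices, but by [I1P] and
   [I2P] the value of [g] does not depend on them, so [g] is bilinear. *)
pose g a1 a2 := P (I1 (s1 a1)) * P (I2 (s2 a2)).
have g_bil : bilinear_map g.
  split=> [a1 c x y|a2 c x y]; rewrite /g.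
    rewrite scalerAr -mulrDr -linearP -linearP; congr (_ * _); apply: I2P.
    by rewrite linearP /= !s2P.
  rewrite scalerAl -mulrDl -linearP -linearP; congr (_ * _); apply: I1P.
  by rewrite linearP /= !s1P.
(* One composite, checked on monomials: [iK] reassembles [u] from its two parts. *)
have gF f : tensor_lift g (F f) = P f.
  move: f; apply: malg_linear_ext => [c x y|c x y|u].
  - by rewrite linearP (tensor_lift_linear g_bil).
  - by rewrite linearP.
  rewrite /split_tensor malg_liftU (tensor_lift_pure g_bil) /g.
  rewrite (I1P (s1P _)) (I2P (s2P _)) -rmorphM !malg_liftU.
  by rewrite malgUM iK.
exists (F \o s); split=> [c x y||] /=.
- by rewrite -linearP; apply: FP; rewrite linearP /= !sP.
- split=> [|x y] /=.
    by rewrite -F1; apply: FP; rewrite sP rmorph1.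
  by rewrite -split_tensorM; apply: FP; rewrite rmorphM /= !sP; reflexivity.
apply: (Bijective (g := tensor_lift g)) => [x|t] /=; first by rewrite gF sP.
move: t; apply: tensor_linear_ext => [c x y|//|a b].
  by rewrite (tensor_lift_linear g_bil) -linearP; apply: FP; rewrite linearP /= !sP.
(* The other composite: [FI] gives an explicit preimage of each pure tensor. *)
rewrite (tensor_lift_pure g_bil) -[a in RHS]s1P -[b in RHS]s2P -FI.
by apply: FP; rewrite sP rmorphM.
Qed.

End TensorIso.

(** * Monomials over subsets of the variables: restriction and extension *)

Lemma cm_eqP (I : choiceType) (u v : {cmonom I}) : u =1 v -> u = v.
Proof. by move=> uv; apply/eqP/cmP. Qed.

Lemma cm_mulIm (I : choiceType) (w : {cmonom I}) : injective (fun u => mmul u w).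
Proof.
move=> u v /= uv; apply: cm_eqP => i; apply: (@addIn (w i)).
by rewrite -!cmM uv.
Qed.

Definition cm_of (I : finType) (f : I -> nat) : {cmonom I} :=
  [cmonom f i | i in [fset i | i : I]]%M.

Lemma cm_ofE (I : finType) (f : I -> nat) : cm_of f =1 f.
Proof. by move=> i; rewrite cmE fsfunE in_fset. Qed.

Section Transfer.
Context (S : finType).
Implicit Types (D E : {set S}).

(** Exponents as a function on all of [S], with 0 outside [D], so that monomials over different
    subsets can be compared without casts between subtypes. *)
Definition cm_ext D (u : {cmonom {x : S | x \in D}}) (x : S) : nat :=
  if insub x is Some y then u y else 0%N.

Lemma cm_ext_val D (u : {cmonom {x : S | x \in D}}) y : cm_ext u (val y) = u y.
Proof. by rewrite /cm_ext valK. Qed.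

Lemma cm_ext_out D (u : {cmonom {x : S | x \in D}}) x :
  x \notin D -> cm_ext u x = 0%N.
Proof. by move=> xD; rewrite /cm_ext insubN. Qed.

Lemma cm_ext_inj D (u v : {cmonom {x : S | x \in D}}) :
  cm_ext u =1 cm_ext v -> u = v.
Proof. by move=> uv; apply: cm_eqP => y; rewrite -!cm_ext_val uv. Qed.

Lemma cm_extM D (u v : {cmonom {x : S | x \in D}}) x :
  cm_ext (mmul u v) x = (cm_ext u x + cm_ext v x)%N.
Proof. by rewrite /cm_ext; case: insubP => // y _ _; rewrite cmM. Qed.

Lemma cm_ext1 D x : cm_ext (mone : {cmonom {x : S | x \in D}}) x = 0%N.
Proof. by rewrite /cm_ext; case: insubP => // y _ _; rewrite cm1. Qed.

(* Serves both as restriction (E \subset D) and as extension by 0 (D \subset E). *)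
Definition transfer D E (u : {cmonom {x : S | x \in D}}) :
    {cmonom {x : S | x \in E}} :=
  cm_of (fun y => cm_ext u (val y)).

Lemma cm_ext_of D (f : S -> nat) x :
  cm_ext (cm_of (fun y : {x : S | x \in D} => f (val y))) x =
  if x \in D then f x else 0%N.
Proof.
rewrite /cm_ext; case: insubP => [y -> <-|/negbTE->//].
by rewrite cm_ofE.
Qed.

Lemma cm_ext_transfer D E (u : {cmonom {x : S | x \in D}}) x :
  cm_ext (transfer E u) x = if x \in E then cm_ext u x else 0%N.
Proof. exact: cm_ext_of. Qed.

Lemma transferM D E : {morph @transfer D E : u v / mmul u v}.
Proof.
move=> u v; apply: cm_ext_inj => x; rewrite cm_extM !cm_ext_transfer cm_extM.
by case: ifP.
Qed.

Lemma transfer1 D E : @transfer D E mone = mone.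
Proof. by apply: cm_ext_inj => x; rewrite cm_ext_transfer !cm_ext1 if_same. Qed.

Lemma transferK D E : D \subset E -> cancel (@transfer D E) (@transfer E D).
Proof.
move=> /subsetP DE u; apply: cm_ext_inj => x; rewrite !cm_ext_transfer.
by case: ifP => [/DE->//|/negbT/cm_ext_out->].
Qed.

End Transfer.

(** * The toric map on monomials *)

Section ToricDegree.
Context (K : fieldType) (T : finType).
Implicit Types (G : sgraph T).

(** The monomial to which the toric map sends [u]. The sum may run over all sets [e], because
    [cm_ext u] vanishes off the edges. *)
Definition tdeg G (u : {cmonom (edge G)}) : {cmonom (vertex G)} :=
  cm_of (fun x => (\sum_(e : {set T} | val x \in e) cm_ext u e)%N).

Lemma cm_ext_tdeg G (u : {cmonom (edge G)}) x :
  cm_ext (tdeg u) x = (\sum_(e : {set T} | x \in e) cm_ext u e)%N.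
Proof.
rewrite [LHS](@cm_ext_of _ _ (fun x => (\sum_(e : {set T} | x \in e) cm_ext u e)%N)).
case: ifPn => // xG; rewrite big1 // => e xe; apply: cm_ext_out.
apply: contra xG => /edgesP /andP[/subsetP eG _]; exact: eG.
Qed.

Lemma cm_prodE (I J : finType) (P : pred J) (F : J -> {cmonom I}) i :
  (\big[mmul/mone]_(j | P j) F j) i = (\sum_(j | P j) F j i)%N.
Proof.
by apply: (big_morph (fun u : {cmonom I} => u i)) => [u v|]; rewrite ?cmM ?cm1.
Qed.

Lemma malgU_prod (M : conomType) (J : finType) (P : pred J) (F : J -> M) :
  \prod_(j | P j) << F j >> = << \big[mmul/mone]_(j | P j) F j >> :> {malg K[M]}.
Proof.
symmetry; apply: (big_morph (fun u : M => << u >> : {malg K[M]})) => //.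
by move=> u v; rewrite malgUM.
Qed.

Lemma malgUX (M : conomType) (w : M) n :
  << w >> ^+ n = << \big[mmul/mone]_(i < n) w >> :> {malg K[M]}.
Proof.
by elim: n => [|n IH]; rewrite ?big_ord0 // exprS IH big_ord_recl malgUM.
Qed.

Lemma toric_monE G (u : {cmonom (edge G)}) : toric_mon K u = << tdeg u >>.
Proof.
rewrite /toric_mon; under eq_bigr => e _ do
  rewrite /edge_image malgU_prod malgUX.
rewrite malgU_prod; congr << _ >>; apply: cm_eqP => x.
rewrite cm_prodE cm_ofE (bigID (mem (edges G))).
rewrite [X in _ = (_ + X)%N]big1 /= => [|e]; last first.
  by case/andP=> _; apply: cm_ext_out.
rewrite addn0 (eq_bigl _ _ (fun e => andbC _ _)) big_sub_cond /= [RHS]big_mkcond /=.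
apply: eq_bigr => e _.
rewrite cm_prodE sum_nat_const card_ord cm_ext_val cm_prodE big_mkcond /= (bigD1 x) //=.
rewrite cmUU big1 ?addn0 => [|y /negbTE yx]; last by rewrite cmU yx if_same.
by case: ifP; rewrite ?muln1 ?muln0.
Qed.

Lemma toric_mapU G (u : {cmonom (edge G)}) :
  toric_map (<< u >> : polyring K (edge G)) = << tdeg u >>.
Proof. by rewrite /toric_map mmapU mul1r toric_monE. Qed.

(** A function that is constant on the fibres of [tdeg] factors through the toric map, so its linear
    extension kills the kernel. *)
Lemma toric_ker_lift G (V : lmodType K) (h : {cmonom (edge G)} -> V) f :
  (forall u v, tdeg u = tdeg v -> h u = h v) ->
  toric_map f = 0 :> polyring K (vertex G) -> malg_lift h f = 0.
Proof.
move=> hh f0.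
(* The induced function on vertex monomials, with default 0 off the image of [tdeg]. *)
pose H (w : {cmonom (vertex G)}) : V :=
  if pselect (exists u, tdeg u = w) is left ex then h (sval (cid ex)) else 0.
have -> : malg_lift h f = malg_lift H (toric_map f).
  move: {f0} f; apply: malg_linear_ext => [c x y|c x y|u]; rewrite ?linearP //.
  rewrite toric_mapU !malg_liftU /H; case: pselect => [ex|[]]; last by exists u.
  by apply: hh; rewrite (svalP (cid ex)).
by rewrite f0 linear0.
Qed.

End ToricDegree.

(** * Graphs whose toric relations split *)

Lemma sum_setU_cond (I : finType) (V : nmodType) (A B : {set I}) (P : pred I)
    (F : I -> V) : [disjoint A & B] ->
  \sum_(i in A :|: B | P i) F i =
  \sum_(i in A | P i) F i + \sum_(i in B | P i) F i.
Proof.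
move=> dis; rewrite !big_mkcondr -bigU //.
by apply: eq_bigl => i; rewrite !inE.
Qed.

Section Splitting.
Context (T : finType).

(* splits_weight says that the toric relations of G are generated by those of G1
   and of G2. *)
Record splits (G G1 G2 : sgraph T) : Prop := Splits {
  splits_edges : edges G = edges G1 :|: edges G2;
  splits_disj : [disjoint edges G1 & edges G2];
  splits_verts1 : verts G1 \subset verts G;
  splits_verts2 : verts G2 \subset verts G;
  splits_weight : forall w : {set T} -> int,
    (forall x, \sum_(e in edges G | x \in e) w e = 0) ->
    forall x, \sum_(e in edges G1 | x \in e) w e = 0 }.

(** Vertex sums over [G] are those over [G1] plus those over [G2], so the condition on weights is
    symmetric although it names [G1] only. *)
Lemma splits_sym (G G1 G2 : sgraph T) : splits G G1 G2 -> splits G G2 G1.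
Proof.
case=> eE dis v1 v2 wt; split; rewrite // ?[_ :|: edges G1]setUC // 1?disjoint_sym //.
by move=> w w0 x; have := w0 x; rewrite eE sum_setU_cond // wt // add0r.
Qed.

Context (G G1 G2 : sgraph T) (sp : splits G G1 G2).

Lemma splits_sub1 : edges G1 \subset edges G.
Proof. by rewrite (splits_edges sp) subsetUl. Qed.

Lemma tdeg_transfer (a : {cmonom (edge G1)}) :
  tdeg (transfer (edges G) a : {cmonom (edge G)}) = transfer (verts G) (tdeg a).
Proof.
apply: cm_ext_inj => x; rewrite cm_ext_transfer !cm_ext_tdeg.
under eq_bigr => e _ do rewrite cm_ext_transfer.
rewrite -cm_ext_tdeg.
have -> : (\sum_(e : {set T} | x \in e) (if e \in edges G then cm_ext a e else 0) =
  cm_ext (tdeg a) x)%N.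
  rewrite cm_ext_tdeg; apply: eq_bigr => e _; case: ifPn => // eG.
  by rewrite cm_ext_out //; apply: contra eG; apply: (subsetP splits_sub1).
by case: ifPn => // xG; apply: cm_ext_out; apply: contra xG;
  apply: (subsetP (splits_verts1 sp)).
Qed.

(** The difference of the exponents of [u] and [v] is an integral weighting whose sum at every
    vertex vanishes, so [splits_weight] applies to it. *)
Lemma tdeg_restrict (u v : {cmonom (edge G)}) : tdeg u = tdeg v ->
  tdeg (transfer (edges G1) u : {cmonom (edge G1)}) = tdeg (transfer (edges G1) v).
Proof.
move=> uv; apply: cm_ext_inj => x; rewrite !cm_ext_tdeg.
under eq_bigr => e _ do rewrite cm_ext_transfer.
under [RHS]eq_bigr => e _ do rewrite cm_ext_transfer.
rewrite -!big_mkcondr /=.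
pose w e := (cm_ext u e)%:Z - (cm_ext v e)%:Z.
have wE (D : {set {set T}}) y : \sum_(e in D | y \in e) w e =
    (\sum_(e : {set T} | (y \in e) && (e \in D)) cm_ext u e)%N%:Z -
    (\sum_(e : {set T} | (y \in e) && (e \in D)) cm_ext v e)%N%:Z.
  rewrite -!natz !natr_sum -sumrB.
  by apply: eq_big => [e|e _]; [rewrite andbC|rewrite !natz].
have w0 y : \sum_(e in edges G | y \in e) w e = 0.
  have ext (z : {cmonom (edge G)}) :
      (\sum_(e : {set T} | (y \in e) && (e \in edges G)) cm_ext z e)%N =
      cm_ext (tdeg z) y.
    rewrite cm_ext_tdeg big_mkcondr; apply: eq_bigr => e _.
    by case: ifPn => // /cm_ext_out->.
  by rewrite wE !ext uv subrr.
by have /eqP := splits_weight sp w0 x; rewrite wE subr_eq0 => /eqP[].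
Qed.

End Splitting.

(* s1 and s2 are the signs of bipartitions of G1 and of G2 in which v1 and v2 lie
   in the same, respectively in different, classes. *)
Lemma splits_signs (T : finType) (G G1 G2 : sgraph T) (v1 v2 : T) (s1 s2 : T -> int) :
  edges G = edges G1 :|: edges G2 ->
  verts G1 \subset verts G -> verts G2 \subset verts G -> v1 != v2 ->
  (forall e1 e2 x, e1 \in edges G1 -> e2 \in edges G2 -> x \in e1 -> x \in e2 ->
     x \in [set v1; v2]) ->
  (forall e, e \in edges G1 -> \sum_(x in e) s1 x = 0) -> s1 v1 = 1 -> s1 v2 = 1 ->
  (forall e, e \in edges G2 -> \sum_(x in e) s2 x = 0) -> s2 v1 = 1 -> s2 v2 = -1 ->
  splits G G1 G2.
Proof.
move=> eE vG1 vG2 v12 meet s1e s11 s12 s2e s21 s22.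
have dis : [disjoint edges G1 & edges G2].
  rewrite disjoint_subset; apply/subsetP => e e1; apply/negP => e2.
  (* A common edge would have to join [v1] and [v2], where the signs [s1] add up to 2, not 0. *)
  suff eE' : e = [set v1; v2].
    by have := s1e _ e1; rewrite eE' big_setU1 ?inE //= big_set1 s11 s12.
  apply/eqP; rewrite eqEcard cards2 v12; case/andP: (edgesP e1) => _ /eqP->.
  by rewrite andbT; apply/subsetP => x xe; apply: (meet _ _ _ e1 e2).
split=> // w w0; pose D1 x := \sum_(e in edges G1 | x \in e) w e.
pose D2 x := \sum_(e in edges G2 | x \in e) w e.
have D12 x : D1 x + D2 x = 0 by rewrite -[RHS](w0 x) eE sum_setU_cond.
have D1_out x : x \notin [set v1; v2] -> D1 x = 0.
  move=> xv; case: (pickP (fun e : {set T} => (e \in edges G1) && (x \in e))).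
    move=> e1 /andP[e1G xe1]; have := D12 x; rewrite [D2 x]big1 ?addr0 // => e2.
    by case/andP=> e2G xe2; case/negP: xv; apply: (meet _ _ _ e1G e2G).
  by move=> none; rewrite /D1 big_pred0.
(* Double counting: after exchanging the sums, each edge contributes its weight times the sum of the
   signs of its ends, which is 0. *)
have sumD (H : sgraph T) (s : T -> int) :
    (forall e, e \in edges H -> \sum_(x in e) s x = 0) ->
    \sum_x s x * \sum_(e in edges H | x \in e) w e = 0.
  move=> se; under eq_bigr => x _ do rewrite mulr_sumr.
  rewrite (exchange_big_dep (mem (edges H))) /=; last by move=> x e _ /andP[].
  rewrite big1 // => e eH; rewrite -mulr_suml.
  by under eq_bigl => x do rewrite eH /=; rewrite se ?mul0r.
have sumv (s : T -> int) (D : T -> int) : (forall x, x \notin [set v1; v2] -> D x = 0) ->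
    \sum_x s x * D x = s v1 * D v1 + s v2 * D v2.
  move=> D0; rewrite (bigID (mem [set v1; v2])) /= [X in _ + X]big1 => [|x /D0->].
    by rewrite big_setU1 ?inE //= big_set1 addr0.
  by rewrite mulr0.
have D2E x : D2 x = - D1 x by apply/eqP; rewrite -addr_eq0 addrC D12.
have := sumD _ _ s1e; rewrite (sumv _ _ D1_out) s11 s12 !mul1r => h1.
have D2_out x : x \notin [set v1; v2] -> D2 x = 0.
  by rewrite D2E => /D1_out->; rewrite oppr0.
have := sumD _ _ s2e; rewrite (sumv _ _ D2_out) s21 s22 mul1r mulN1r.
rewrite -!/(D2 _) !D2E => h2.
(* [h1] gives [D1 v1 = - D1 v2] and [h2] gives [D1 v1 = D1 v2]. *)
have D1v1 : D1 v1 = 0 by move: h1 h2; rewrite /D1; lia.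
have D1v2 : D1 v2 = 0 by move: h1; rewrite -/(D1 _) D1v1 add0r.
move=> x; rewrite -/(D1 x); case: (boolP (x \in [set v1; v2])) => [|/D1_out//].
by rewrite !inE => /orP[] /eqP->.
Qed.

(** * Initial monomials of toric ideals *)

Lemma mle_refl (X : choiceType) (le : monomial_order X) u : le u u.
Proof. by have := mle_total le u u; rewrite orbb. Qed.

Lemma mcoeff_binomial (K : nzRingType) (M : choiceType) (u v w : M) :
  (<< u >> - << v >> : {malg K[M]})@_w = (u == w)%:R - (v == w)%:R.
Proof. by rewrite mcoeffB; congr (_ - _); apply: mcoeffU. Qed.

Section InitialToric.
Context (K : fieldType) (T : finType) (G : sgraph T) (le : monomial_order (edge G)).

Lemma toric_idealE f : (f \in toric_ideal K G) = (toric_map f == 0).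
Proof. by []. Qed.

Lemma toric_mapU_eq (u v : {cmonom (edge G)}) : tdeg u = tdeg v ->
  toric_map (<< u >> : polyring K (edge G)) = toric_map << v >>.
Proof.
(* rewrite would compare << u >> and << v >> by unfolding, which blows up *)
move=> tuv; apply: etrans (toric_mapU K u) _; apply: etrans (esym (toric_mapU K v)).
by rewrite tuv.
Qed.

Lemma toric_binomial (u v : {cmonom (edge G)}) : tdeg v = tdeg u ->
  (<< u >> - << v >> : polyring K (edge G)) \in toric_ideal K G.
Proof.
by move=> tvu; rewrite toric_idealE raddfB subr_eq0; apply/eqP/toric_mapU_eq.
Qed.

(** If [u] were the only monomial of [f] in its fibre, its nonzero coefficient would survive in
    [toric_map f]. *)
Lemma toric_initial_fibre f u : f \in toric_ideal K G -> is_initial le f u ->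
  exists v, [/\ v != u, le v u & tdeg v = tdeg u].
Proof.
move=> f0 [uf leu]; apply: contrapT => none.
have noneP v : v \in msupp f -> v != u -> tdeg v != tdeg u.
  by move=> vf vu; apply/negP => /eqP tv; apply: none; exists v; rewrite leu.
have : (toric_map f)@_(tdeg u) = f@_u.
  rewrite /toric_map mmapE raddf_sum (big_fsetD1 u) //= big_seq big1.
    by rewrite toric_monE mul_malgC mcoeffZ mcoeffUU mulr1 addr0.
  move=> v /fsetD1P[vu vf]; rewrite toric_monE mul_malgC mcoeffZ mcoeffU1.
  by rewrite (negbTE (noneP v vf vu)) mulr0.
by rewrite (eqP f0) mcoeff0 => /esym/eqP; rewrite mcoeff_eq0 uf.
Qed.

(** The binomial [<< u >> - << v >>] has initial monomial [u]. With the preceding lemma, the initial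
    monomials are exactly those that are not minimal in their fibre. *)
Lemma toric_fibre_initial u v : v != u -> le v u -> tdeg v = tdeg u ->
  << u >> \in initial_ideal le (toric_ideal K G).
Proof.
move=> vu levu tvu; apply/asboolP; exists [:: (1, << u >>)].
split=> [p|]; last by rewrite big_seq1 mul1r.
rewrite inE => /eqP-> /=; exists (<< u >> - << v >>), u; split=> //.
  exact: toric_binomial.
split.
  by rewrite -mcoeff_neq0 mcoeff_binomial eqxx (negbTE vu) subr0 oner_eq0.
move=> w; rewrite -mcoeff_neq0 mcoeff_binomial.
case: (eqVneq u w) => [<- _|_]; first exact: mle_refl.
by case: (eqVneq v w) => [<- //|_]; rewrite subrr eqxx.
Qed.

End InitialToric.

(** * The block order built from two monomial orders *)

Section BlockOrder.
Context (X X1 X2 : choiceType).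
Context (r1 : {cmonom X} -> {cmonom X1}) (r2 : {cmonom X} -> {cmonom X2}).
Hypothesis r1_1 : r1 mone = mone.
Hypothesis r2_1 : r2 mone = mone.
Hypothesis r1M : {morph r1 : u v / mmul u v}.
Hypothesis r2M : {morph r2 : u v / mmul u v}.
Hypothesis r_inj : forall u v, r1 u = r1 v -> r2 u = r2 v -> u = v.
Context (le1 : monomial_order X1) (le2 : monomial_order X2).

Definition block_le : rel {cmonom X} := fun u v =>
  if r1 u == r1 v then le2 (r2 u) (r2 v) else le1 (r1 u) (r1 v).

Fact block_le_anti : antisymmetric block_le.
Proof.
move=> u v; rewrite /block_le [r1 v == _]eq_sym; case: eqVneq => [e /mle_anti|ne].
  exact: r_inj.
by move/mle_anti/eqP; rewrite (negbTE ne).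
Qed.

Fact block_le_trans : transitive block_le.
Proof.
move=> v u w; rewrite /block_le; case: (eqVneq (r1 u) (r1 v)) => [->|uv].
  by case: eqVneq => // _; apply: mle_trans.
case: (eqVneq (r1 v) (r1 w)) => [<-|vw]; first by rewrite (negbTE uv).
case: (eqVneq (r1 u) (r1 w)) => [->|_]; last exact: mle_trans.
(* Here [r1 v] is squeezed between two equal monomials, against [vw]. *)
by move=> wv vw'; case/negP: vw; apply/eqP/(@mle_anti _ le1); rewrite vw' wv.
Qed.

Fact block_le_total : total block_le.
Proof.
move=> u v; rewrite /block_le [r1 v == _]eq_sym.
by case: eqVneq => _; apply: mle_total.
Qed.

Fact block_le1 u : block_le mone u.
Proof. by rewrite /block_le r1_1 r2_1; case: ifP => _; apply: mle1. Qed.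

Fact block_leM u v w : block_le u v -> block_le (mmul u w) (mmul v w).
Proof.
rewrite /block_le !r1M !r2M (inj_eq (@cm_mulIm _ _)).
by case: ifP => _; apply: mleM.
Qed.

Definition block_order : monomial_order X :=
  MonomialOrder block_le_anti block_le_trans block_le_total block_le1 block_leM.

End BlockOrder.

(** * Projections onto the edge ring and onto quotient algebras *)

Section EdgeRingProjection.
Context (K : fieldType) (T : finType) (G : sgraph T).

Definition edge_ring_proj (f : polyring K (edge G)) : edge_ring K G :=
  EdgeRing (introT (toric_imageP _) (ex_intro _ f erefl)).

Fact edge_ring_proj_zmod : zmod_morphism edge_ring_proj.
Proof. by move=> f g; apply: val_inj; rewrite /= raddfB. Qed.

Fact edge_ring_proj_monoid : monoid_morphism edge_ring_proj.
Proof.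
by split=> [|f g]; apply: val_inj; rewrite /= ?rmorph1 // rmorphM.
Qed.

Fact edge_ring_proj_scalable : scalable edge_ring_proj.
Proof. by move=> c f; apply: val_inj; rewrite /= linearZ. Qed.

HB.instance Definition _ :=
  GRing.isZmodMorphism.Build _ _ edge_ring_proj edge_ring_proj_zmod.
HB.instance Definition _ :=
  GRing.isMonoidMorphism.Build _ _ edge_ring_proj edge_ring_proj_monoid.
HB.instance Definition _ :=
  GRing.isScalable.Build K _ _ *:%R edge_ring_proj edge_ring_proj_scalable.

Lemma edge_ring_proj_surj a : exists f, edge_ring_proj f = a.
Proof.
by case: a => g gP; case/toric_imageP: (gP) => f fg; exists f; apply: val_inj.
Qed.

Lemma edge_ring_proj_eq f g : edge_ring_proj f = edge_ring_proj g <->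
  toric_map f = toric_map g.
Proof.
split=> [fg|fg]; last exact: val_inj.
exact: (congr1 (@edge_ring_val K T G) fg).
Qed.

End EdgeRingProjection.

Section QuotProjection.
Context (K : comNzRingType) (R : comAlgType K) (I : idealr R).

HB.instance Definition _ := GRing.isScalable.Build K R (quot_alg R I) *:%R
  (@quot_proj K R I) (@quot_projZ K R I).

Lemma quot_proj_surj (a : quot_alg R I) : exists f, quot_proj I f = a.
Proof. by exists (repr a); apply: quot_projK. Qed.

Lemma quot_proj_eq0 f : quot_proj I f = 0 <-> f \in I.
Proof.
by rewrite -[X in X \in _]subr0 -quot_projP raddf0; split=> /eqP.
Qed.

End QuotProjection.

(** * Both tensor decompositions for a split graph *)

Section SplitRings.
Context (K : fieldType) (T : finType) (G G1 G2 : sgraph T) (sp : splits G G1 G2).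

Local Notation r1 := (transfer (edges G1) : {cmonom (edge G)} -> {cmonom (edge G1)}).
Local Notation r2 := (transfer (edges G2) : {cmonom (edge G)} -> {cmonom (edge G2)}).
Local Notation i1 := (transfer (edges G) : {cmonom (edge G1)} -> {cmonom (edge G)}).
Local Notation i2 := (transfer (edges G) : {cmonom (edge G2)} -> {cmonom (edge G)}).

Lemma transfer_mulK a b : r1 (mmul (i1 a) (i2 b)) = a.
Proof.
rewrite transferM; apply: cm_ext_inj => e; rewrite cm_extM !cm_ext_transfer.
rewrite (splits_edges sp) in_setU; case: ifPn => [e1|/cm_ext_out->//] /=.
by rewrite e1 [cm_ext b e]cm_ext_out ?addn0 // (disjointFr (splits_disj sp) e1).
Qed.

Lemma transfer_split u : mmul (i1 (r1 u)) (i2 (r2 u)) = u.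
Proof.
apply: cm_ext_inj => e; rewrite cm_extM !cm_ext_transfer.
have eE : (e \in edges G) = (e \in edges G1) || (e \in edges G2).
  by rewrite (splits_edges sp) in_setU.
case: ifPn => [|/cm_ext_out->//]; rewrite eE.
case: (boolP (e \in edges G1)) => [/(disjointFr (splits_disj sp))->|_] /=.
  by rewrite addn0.
by move=> ->.
Qed.

Lemma toric_ker_transfer (f : polyring K (edge G1)) : toric_map f = 0 ->
  toric_map (malg_lift (fun a => << i1 a >> : polyring K (edge G)) f) = 0.
Proof.
move=> f0; pose j (w : {cmonom (vertex G1)}) : polyring K (vertex G) :=
  << transfer (verts G) w >>.
have -> : toric_map (malg_lift (fun a => << i1 a >> : polyring K (edge G)) f) =
    malg_lift j (toric_map f).
  move: {f0} f; apply: malg_linear_ext => [c x y|c x y|a]; rewrite ?linearP //.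
  by rewrite malg_liftU !toric_mapU malg_liftU (tdeg_transfer sp).
by rewrite f0 linear0.
Qed.

End SplitRings.

(** Extension by 0 carries a smaller monomial of the same fibre to a smaller monomial of the same
    fibre, hence initial monomials to initial monomials. *)
Lemma initial_transfer (K : fieldType) (T : finType) (G G1 G2 : sgraph T)
    (sp : splits G G1 G2) (le : monomial_order (edge G))
    (le1 : monomial_order (edge G1)) (f : polyring K (edge G1)) :
  (forall a b, le1 a b -> le (transfer (edges G) a) (transfer (edges G) b)) ->
  f \in initial_ideal le1 (toric_ideal K G1) ->
  malg_lift (fun a => << transfer (edges G) a >> : polyring K (edge G)) f
    \in initial_ideal le (toric_ideal K G).
Proof.
move=> le_tr /asboolP[s [sI ->]]; rewrite raddf_sum big_seq.
apply: rpred_sum => p /sI[g [u [gI ug ->]]] /=.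
rewrite (malg_lift_mul (malg_mul_bil _ _)) => [|a b]; last by rewrite transferM malgUM.
apply: idealMr; rewrite malg_liftU.
have [v [vu levu tvu]] := toric_initial_fibre gI ug.
apply: (@toric_fibre_initial _ _ _ _ _ (transfer (edges G) v)).
- by rewrite (can_eq (transferK (splits_sub1 sp))).
- exact: le_tr.
- by rewrite !(tdeg_transfer sp) tvu.
Qed.

Section SplitIso.
Context (K : fieldType) (T : finType) (G G1 G2 : sgraph T) (sp : splits G G1 G2).

Local Notation r1 := (transfer (edges G1) : {cmonom (edge G)} -> {cmonom (edge G1)}).
Local Notation r2 := (transfer (edges G2) : {cmonom (edge G)} -> {cmonom (edge G2)}).
Local Notation i1 := (transfer (edges G) : {cmonom (edge G1)} -> {cmonom (edge G)}).
Local Notation i2 := (transfer (edges G) : {cmonom (edge G2)} -> {cmonom (edge G)}).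

Lemma transfer_mulK2 a b : r2 (mmul (i1 a) (i2 b)) = b.
Proof. by rewrite mulmC; apply: (transfer_mulK (splits_sym sp)). Qed.

Lemma edge_ring_split :
  iso_tensor (edge_ring K G) (edge_ring K G1) (edge_ring K G2).
Proof.
have ker0 (H : sgraph T) (f : polyring K (edge H)) :
    edge_ring_proj f = 0 <-> toric_map f = 0.
  by rewrite -[0 in X in X <-> _](raddf0 (@edge_ring_proj K T H))
    edge_ring_proj_eq raddf0.
apply: (@tensor_iso _ _ _ _ _ _ _ (@edge_ring_proj K T G) (@edge_ring_proj K T G1)
  (@edge_ring_proj K T G2) _ _ _ r1 r2 i1 i2).
- exact: edge_ring_proj_surj.
- exact: edge_ring_proj_surj.
- exact: edge_ring_proj_surj.
- exact: transfer1.
- exact: transfer1.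
- exact: transferM.
- exact: transferM.
- exact: transfer_mulK.
- exact: transfer_mulK2.
- exact: transfer_split.
- move=> f /ker0 f0; apply: (toric_ker_lift _ f0) => u v uv.
  by apply: congr2; apply/edge_ring_proj_eq/toric_mapU_eq;
    [apply: (tdeg_restrict sp)|apply: (tdeg_restrict (splits_sym sp))].
- by move=> f /ker0 f0; apply/ker0; apply: (toric_ker_transfer sp).
- by move=> f /ker0 f0; apply/ker0; apply: (toric_ker_transfer (splits_sym sp)).
Qed.

Context (le1 : monomial_order (edge G1)) (le2 : monomial_order (edge G2)).

Fact restrict_inj u v : r1 u = r1 v -> r2 u = r2 v -> u = v.
Proof.
by move=> e1 e2; rewrite -[u](transfer_split sp) e1 e2 transfer_split.
Qed.

Definition split_order : monomial_order (edge G) :=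
  block_order (@transfer1 _ _ _) (@transfer1 _ _ _) (@transferM _ _ _)
    (@transferM _ _ _) restrict_inj le1 le2.

Lemma split_order_ext1 a b : le1 a b -> split_order (i1 a) (i1 b).
Proof.
have r1K c : r1 (i1 c) = c := transferK (splits_sub1 sp) c.
(* Write [i1 c] as [i1 c] times [i2] of the unit monomial. *)
have r2K c : r2 (i1 c) = mone.
  by rewrite -[RHS](transfer_mulK2 c mone) transfer1 mulm1.
by rewrite /split_order /= /block_le !r1K !r2K mle_refl; case: ifP.
Qed.

Lemma split_order_ext2 a b : le2 a b -> split_order (i2 a) (i2 b).
Proof.
have r2K c : r2 (i2 c) = c := transferK (splits_sub1 (splits_sym sp)) c.
have r1K c : r1 (i2 c) = mone.
  by rewrite -[RHS](transfer_mulK sp mone c) transfer1 mul1m.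
by rewrite /split_order /= /block_le !r1K !r2K eqxx.
Qed.

Lemma split_initial (f : polyring K (edge G)) u :
  f \in toric_ideal K G -> is_initial split_order f u ->
  << r1 u >> \in initial_ideal le1 (toric_ideal K G1) \/
  << r2 u >> \in initial_ideal le2 (toric_ideal K G2).
Proof.
move=> fI uf; have [v [vu + tvu]] := toric_initial_fibre fI uf.
rewrite /split_order /= /block_le; case: eqVneq => [e1 le2vu|ne1 le1vu].
- right; apply: toric_fibre_initial le2vu (tdeg_restrict (splits_sym sp) tvu).
  (* As [u] and [v] agree under [r1] but differ, they differ under [r2]. *)
  by apply: contra vu => /eqP e2; apply/eqP/restrict_inj.
- by left; apply: toric_fibre_initial le1vu (tdeg_restrict sp tvu).
Qed.

Lemma initial_quot_split :
  iso_tensor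
    (quot_alg (polyring K (edge G)) (initial_ideal split_order (toric_ideal K G)))
    (quot_alg (polyring K (edge G1)) (initial_ideal le1 (toric_ideal K G1)))
    (quot_alg (polyring K (edge G2)) (initial_ideal le2 (toric_ideal K G2))).
Proof.
apply: (@tensor_iso _ _ _ _ _ _ _ (@quot_proj K _ _) (@quot_proj K _ _)
  (@quot_proj K _ _) _ _ _ r1 r2 i1 i2).
- exact: quot_proj_surj.
- exact: quot_proj_surj.
- exact: quot_proj_surj.
- exact: transfer1.
- exact: transfer1.
- exact: transferM.
- exact: transferM.
- exact: transfer_mulK.
- exact: transfer_mulK2.
- exact: transfer_split.
- move=> f /quot_proj_eq0 /asboolP[s [sI ->]]; rewrite raddf_sum /= big_seq.
  apply: big1 => p /sI[g [u [gI ug ->]]].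
  rewrite split_tensorM; [|exact: transferM|exact: transferM].
  rewrite /split_tensor malg_liftU.
  (* By [split_initial], one tensor factor of the image of [u] is 0. *)
  rewrite [X in _ * X](_ : _ = 0) ?mulr0 //.
  case: (split_initial gI ug) => /quot_proj_eq0 e0.
    by apply: etrans (pure_tensor0l _ _); apply: (congr1 (fun x => pure_tensor x _)).
  by apply: etrans (pure_tensor0r _ _); apply: (congr1 (fun x => pure_tensor _ x)).
- move=> f /quot_proj_eq0 f0; apply/quot_proj_eq0.
  exact: initial_transfer sp _ _ _ split_order_ext1 f0.
- move=> f /quot_proj_eq0 f0; apply/quot_proj_eq0.
  exact: initial_transfer (splits_sym sp) _ _ _ split_order_ext2 f0.
Qed.

End SplitIso.

(** * Multi-path graphs of mixed type split by parity *)

Section MultipathSplit.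
Context (m : nat) (l : 'I_m -> nat).

Lemma paths_edges_vertex (S : {set 'I_m}) e (x : mp_vertex l) :
  e \in paths_edges l S -> x \in e -> x \notin [set mp_v1 l; mp_v2 l] ->
  exists i j, i \in S /\ x = inr (existT (fun i => 'I_(l i).-1) i j).
Proof.
rewrite inE => /exists_inP[i iS] /existsP[k /eqP->] xe xv.
have [n xE] : exists n, x = path_vertex l i n.
  by move: xe; rewrite !inE => /orP[] /eqP->; [exists k|exists k.+1].
move: xv; rewrite xE /path_vertex; case: ifP => _; first by rewrite !inE eqxx.
case: insubP => [j _ _ _|_]; first by exists i, j.
by rewrite !inE eqxx orbT.
Qed.

(** The sign is the parity of the position on a path counted from [mp_v1]; the inner vertex of index
    [j] stands at position [j + 1]. The bit [b] is the common parity of the path lengths and fixes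
    the sign of [mp_v2]. *)
Definition path_sign (b : bool) (x : mp_vertex l) : int :=
  match x with
  | inl v => if v then (-1) ^+ b else 1
  | inr p => (-1) ^+ (tagged p).+1
  end.

Lemma path_sign_vertex i k : (k <= l i)%N ->
  path_sign (odd (l i)) (path_vertex l i k) = (-1) ^+ k.
Proof.
case: k => [|k] kl //; rewrite /path_vertex /=.
case: insubP => [j _ /= ->//|]; rewrite -leqNgt => lk /=.
(* The vertex is [mp_v2], and the bounds force [k.+1 = l i]. *)
by rewrite signr_odd; congr (_ ^+ _); lia.
Qed.

Lemma path_sign_edge (b : bool) e : e \in paths_edges l [set i | odd (l i) == b] ->
  \sum_(x in e) path_sign b x = 0.
Proof.
rewrite inE => /exists_inP[i]; rewrite inE => /eqP<- /existsP[k /eqP->].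
rewrite big_setU1 ?inE ?path_vertex_neq //= big_set1.
rewrite !path_sign_vertex ?(ltnW (ltn_ord k)) ?ltn_ord //.
by rewrite exprS mulN1r subrr.
Qed.

Lemma paths_verts_sub (S : {set 'I_m}) : paths_verts l S \subset paths_verts l setT.
Proof.
apply/subsetP => x; rewrite !inE => /exists_inP[i _ h].
by apply/exists_inP; exists i.
Qed.

Lemma multipath_splits : splits (multipath l) (even_part l) (odd_part l).
Proof.
have oddE : [set i | odd (l i)] = [set i | odd (l i) == true].
  by apply/setP => i; rewrite !inE eqb_id.
have evenE : [set i | ~~ odd (l i)] = [set i | odd (l i) == false].
  by apply/setP => i; rewrite !inE eqbF_neg.
apply: (@splits_signs _ _ _ _ (mp_v1 l) (mp_v2 l) (path_sign false)
  (path_sign true)) => //=.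
- apply/setP => e; rewrite !inE; apply/idP/idP.
    move=> /exists_inP[i _ h]; case: (boolP (odd (l i))) => li; apply/orP; [right|left];
    by apply/exists_inP; exists i; rewrite ?inE.
  by case/orP=> /exists_inP[i _ h]; apply/exists_inP; exists i.
- exact: paths_verts_sub.
- exact: paths_verts_sub.
- move=> e1 e2 x he1 he2 xe1 xe2; apply/negPn/negP => xv.
  have [i [j [iE xE]]] := paths_edges_vertex he1 xe1 xv.
  have [i' [j' [iO xE']]] := paths_edges_vertex he2 xe2 xv.
  (* An inner vertex carries the index of its path as its tag, so this path would be both even and
     odd. *)
  have := congr1 (fun y => if y is inr p then tag p else i) (etrans (esym xE) xE').
  by move=> /= ii'; move: iE iO; rewrite -ii' !inE => /negbTE->.
- by move=> e; rewrite evenE; apply: path_sign_edge.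
- by move=> e; rewrite oddE; apply: path_sign_edge.
Qed.

End MultipathSplit.

Theorem lemma3p2 (K : fieldType) (m : nat) (l : 'I_m -> nat)
    (hl : multipath_lengths l) (hmixed : mixed_type l) :
  let G := multipath l in
  let Ge := even_part l in
  let Go := odd_part l in
  iso_tensor (edge_ring K G) (edge_ring K Ge) (edge_ring K Go) /\
  forall (lee : monomial_order (edge Ge)) (leo : monomial_order (edge Go)),
  exists le : monomial_order (edge G),
    iso_tensor (quot_alg (polyring K (edge G)) (initial_ideal le (toric_ideal K G)))
      (quot_alg (polyring K (edge Ge)) (initial_ideal lee (toric_ideal K Ge)))
      (quot_alg (polyring K (edge Go)) (initial_ideal leo (toric_ideal K Go))).
Proof.
move=> G Ge Go; have sp : splits G Ge Go := multipath_splits l.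
split=> [|lee leo]; first exact: edge_ring_split.
by exists (split_order sp lee leo); apply: initial_quot_split.
Qed.
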